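(* Let $f$ be $\rho$-weakly convex and $r$ be $\eta$-weakly convex on $\mathbb{X}$, so that $\varphi=f+r$ is $(\rho+\eta)$-weakly convex, and let $0<\lambda<\frac{1}{\rho+\eta}$. Then: (i) If $\varphi$ satisfies the global quadratic growth property, i.e. there is $\kappa_{gQG}^\varphi>0$ with $\mathrm{dist}^2(x,\mathbb{X}^* )\le\kappa_{gQG}^\varphi[\varphi(x)-\varphi^*]$ for all $x\in\mathbb{X}$, and the set of critical points $\overline{\mathbb{X}}$ is bounded, then (B$_2$) $\Longrightarrow$ (B$_3$); in other words, (B$_2$) and (B$_3$) are equivalent in this case. (ii) If $\partial\varphi$ satisfies the global metric subregularity property, i.e. there is $\kappa_{gMS}^\varphi>0$ with $\mathrm{dist}(x,\overline{\mathbb{X}})\le\kappa_{gMS}^\varphi\,\mathrm{dist}(0,\partial\varphi(x)+\mathcal{N}_{\mathbb{X}}(x))$ for all $x\in\mathbb{X}$, and $\overline{\mathbb{X}}$ is bounded, then (B$_2$) $\Longrightarrow$ (B$_4$); in other words, (B$_2$) and (B$_4$) are equivalent in this case. (iii) If there are $\tau\in(0,1)$ and $R_0>0$ such that $\|\mathrm{Prox}_{\lambda,\varphi}(x)\|\le\tau\|x\|$ for all $x\in\mathbb{X}$ with $\|x\|\ge R_0$, then (B$_2$) $\Longrightarrow$ (B$_4$); in other words, (B$_2$) and (B$_4$) are equivalent in this case.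
   Context: Setting: $\mathbb{X}\subseteq\mathbb{R}^d$ is closed and convex; $f,r:\mathbb{X}\to\mathbb{R}$ are proper and lower semicontinuous; $\varphi=f+r$; the set $\mathbb{X}^*$ of minimizers of $\varphi$ over $\mathbb{X}$ is non-empty and $\varphi^*$ is the minimum value. A function $u:\mathbb{X}\to\mathbb{R}$ is $\rho$-weakly convex if $\theta=u+\frac{\rho}{2}\|\cdot\|^2$ is convex; then $\partial u(x)=\partial\theta(x)-\rho x$, where $\partial\theta(x)=\{v:\theta(y)\ge\theta(x)+\langle v,y-x\rangle\ \forall y\in\mathbb{X}\}$. $\mathcal{N}_{\mathbb{X}}(x)=\{d:\langle d,x'-x\rangle\le0\ \forall x'\in\mathbb{X}\}$. The set of critical points is $\overline{\mathbb{X}}=\{x\in\mathbb{X}:0\in\partial\varphi(x)+\mathcal{N}_{\mathbb{X}}(x)\}$. Moreau envelope: $\varphi_\lambda(x)=\min_{y\in\mathbb{X}}\{\varphi(y)+\frac{1}{2\lambda}\|y-x\|^2\}$, with unique minimizer $\mathrm{Prox}_{\lambda,\varphi}(x)$, and $\nabla\varphi_\lambda(x)=\frac1\lambda(x-\mathrm{Prox}_{\lambda,\varphi}(x))$. Conditions (each asserts existence of nonnegative constants such that the bound holds for all $x\in\mathbb{X}$, all $g(x)\in\partial f(x)$ and all $h(x)\in\partial r(x)$): (B$_2$) $\|g(x)+h(x)\|\le c_1\|x\|+c_2$; (B$_3$) $\|g(x)+h(x)\|\le\sqrt{c_3[\varphi_\lambda(x)-\varphi^*]+c_4}$; (B$_4$)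 $\|g(x)+h(x)\|\le\sqrt{c_5\|\nabla\varphi_\lambda(x)\|^2+c_6}$. *)

(* Defs.v *)
From HB Require Import structures.
From mathcomp Require Import all_boot all_order all_algebra.
From mathcomp Require Import all_classical all_reals all_analysis.

Set Implicit Arguments.
Unset Strict Implicit.
Unset Printing Implicit Defensive.

Import Order.TTheory GRing.Theory Num.Theory.
Import numFieldNormedType.Exports.

Local Open Scope classical_set_scope.
Local Open Scope ring_scope.

(* Functions on a set X of R^d are total functions on 'rV[R]_d; every notion
   below only uses their values on X. *)

Definition dot (R : realType) (d : nat) (u v : 'rV[R]_d) : R :=
  \sum_(i < d) u 0 i * v 0 i.

(* The library norm `|x| on 'rV[R]_d is the sup norm, whence this one. *)
Definition norm2 (R : realType) (d : nat) (x : 'rV[R]_d) : R :=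
  Num.sqrt (dot x x).

(* Extended-real valued, so that the distance to the empty set is +oo: the
   subdifferential can be empty at boundary points of X. *)
Definition dist2 (R : realType) (d : nat) (x : 'rV[R]_d) (A : set 'rV[R]_d) :
    \bar R :=
  ereal_inf [set (norm2 (x - a))%:E | a in A].

(* In [subspace X] the neighborhoods of a point of X are the relative ones and
   the points outside X are isolated: this is lower semicontinuity of the
   restriction of u to X. *)
Definition lsc_on (R : realType) (d : nat) (X : set 'rV[R]_d)
    (u : 'rV[R]_d -> R) : Prop :=
  lower_semicontinuous (fun x : subspace X => (u x)%:E).

Definition argmin (R : realType) (d : nat) (X : set 'rV[R]_d)
    (u : 'rV[R]_d -> R) : set 'rV[R]_d :=
  [set x | X x /\ forall y, X y -> u x <= u y].

(* The real [inf] is the minimum as soon as it is attained. *)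
Definition minval (R : realType) (d : nat) (X : set 'rV[R]_d)
    (u : 'rV[R]_d -> R) : R :=
  inf [set u y | y in X].

Definition add_quad (R : realType) (d : nat) (rho : R)
    (u : 'rV[R]_d -> R) (x : 'rV[R]_d) : R :=
  u x + rho / 2 * norm2 x ^+ 2.

Definition weakly_convex (R : realType) (d : nat) (X : set 'rV[R]_d) (rho : R)
    (u : 'rV[R]_d -> R) : Prop :=
  convex_function X (add_quad rho u).

Definition convex_subdiff (R : realType) (d : nat) (X : set 'rV[R]_d)
    (theta : 'rV[R]_d -> R) (x : 'rV[R]_d) : set 'rV[R]_d :=
  [set v | forall y, X y -> theta x + dot v (y - x) <= theta y].

Definition subdiff (R : realType) (d : nat) (X : set 'rV[R]_d) (rho : R)
    (u : 'rV[R]_d -> R) (x : 'rV[R]_d) : set 'rV[R]_d :=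
  [set v - rho *: x | v in convex_subdiff X (add_quad rho u) x].

Definition normal_cone (R : realType) (d : nat) (X : set 'rV[R]_d)
    (x : 'rV[R]_d) : set 'rV[R]_d :=
  [set v | forall y, X y -> dot v (y - x) <= 0].

Definition subdiff_normal (R : realType) (d : nat) (X : set 'rV[R]_d) (rho : R)
    (u : 'rV[R]_d -> R) (x : 'rV[R]_d) : set 'rV[R]_d :=
  [set v + w | v in subdiff X rho u x & w in normal_cone X x].

Definition critical (R : realType) (d : nat) (X : set 'rV[R]_d) (rho : R)
    (u : 'rV[R]_d -> R) : set 'rV[R]_d :=
  [set x | X x /\ subdiff_normal X rho u x 0].

Definition prox_obj (R : realType) (d : nat) (lam : R) (u : 'rV[R]_d -> R)
    (x y : 'rV[R]_d) : R :=
  u y + (2 * lam)^-1 * norm2 (y - x) ^+ 2.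

Definition moreau (R : realType) (d : nat) (X : set 'rV[R]_d) (lam : R)
    (u : 'rV[R]_d -> R) (x : 'rV[R]_d) : R :=
  minval X (prox_obj lam u x).

(* The (chosen) minimizer; the default value 0 is only used when there is none. *)
Definition prox (R : realType) (d : nat) (X : set 'rV[R]_d) (lam : R)
    (u : 'rV[R]_d -> R) (x : 'rV[R]_d) : 'rV[R]_d :=
  xget 0 (argmin X (prox_obj lam u x)).

Definition grad (R : realType) (d : nat) (u : 'rV[R]_d -> R) (x : 'rV[R]_d) :
    'rV[R]_d :=
  \row_(i < d) 'D_(delta_mx 0 i) u x.

Definition linear_bound (R : realType) (d : nat) (X : set 'rV[R]_d)
    (rho eta : R) (f r : 'rV[R]_d -> R) : Prop :=
  exists c1 c2 : R, [/\ 0 <= c1, 0 <= c2 &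
    forall x g h, X x -> subdiff X rho f x g -> subdiff X eta r x h ->
      norm2 (g + h) <= c1 * norm2 x + c2].

Definition moreau_gap_bound (R : realType) (d : nat) (X : set 'rV[R]_d)
    (rho eta lam : R) (f r : 'rV[R]_d -> R) : Prop :=
  let phi := f \+ r in
  exists c3 c4 : R, [/\ 0 <= c3, 0 <= c4 &
    forall x g h, X x -> subdiff X rho f x g -> subdiff X eta r x h ->
      norm2 (g + h) <=
        Num.sqrt (c3 * (moreau X lam phi x - minval X phi) + c4)].

Definition moreau_grad_bound (R : realType) (d : nat) (X : set 'rV[R]_d)
    (rho eta lam : R) (f r : 'rV[R]_d -> R) : Prop :=
  let phi := f \+ r in
  exists c5 c6 : R, [/\ 0 <= c5, 0 <= c6 &
    forall x g h, X x -> subdiff X rho f x g -> subdiff X eta r x h ->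
      norm2 (g + h) <=
        Num.sqrt (c5 * norm2 (grad (moreau X lam phi) x) ^+ 2 + c6)].

Definition global_quadratic_growth (R : realType) (d : nat)
    (X : set 'rV[R]_d) (u : 'rV[R]_d -> R) : Prop :=
  exists2 kappa : R, 0 < kappa &
    forall x, X x ->
      (dist2 x (argmin X u) ^+ 2 <= (kappa * (u x - minval X u))%:E)%E.

Definition global_metric_subregularity (R : realType) (d : nat)
    (X : set 'rV[R]_d) (rho : R) (u : 'rV[R]_d -> R) : Prop :=
  exists2 kappa : R, 0 < kappa &
    forall x, X x ->
      (dist2 x (critical X rho u)
         <= kappa%:E * dist2 0 (subdiff_normal X rho u x))%E.

(* Main.v *)
(* With w the Moreau gap or the squared gradient of the Moreau envelope, the
   two bounds are equivalent as soon as w(x) <= A |x|^2 + B and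
   |x|^2 <= A' w(x) + B' on X. The first inequality follows from comparing the
   prox p of x with a minimizer. For the second, |x| <= |x - p| + |p|, where
   |x - p| is controlled by w and |p| is bounded in each of the three cases:
   the argmin is contained in the bounded critical set and quadratic growth is
   applied at p; (x - p) / lam is a subgradient at p and subregularity is applied
   there; or p is a contraction of x. *)
Require Import Defs.
From HB Require Import structures.
From mathcomp Require Import all_boot all_order all_algebra.
From mathcomp Require Import all_classical all_reals all_analysis.
From mathcomp Require Import ring lra.

Set Implicit Arguments.
Unset Strict Implicit.
Unset Printing Implicit Defensive.

Import Order.TTheory GRing.Theory Num.Theory.
Import numFieldNormedType.Exports.

Local Open Scope classical_set_scope.
Local Open Scope ring_scope.

(** * Euclidean inner product and norm *)

Section euclidean.
Variables (R : realType) (d : nat).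
Implicit Types u v w x y : 'rV[R]_d.

Lemma dotC u v : dot u v = dot v u.
Proof. by apply: eq_bigr => i _; rewrite mulrC. Qed.

Lemma dotDl u v w : dot (u + v) w = dot u w + dot v w.
Proof. by rewrite -big_split; apply: eq_bigr => i _; rewrite mxE mulrDl. Qed.

Lemma dotZl a u w : dot (a *: u) w = a * dot u w.
Proof. by rewrite /dot mulr_sumr; apply: eq_bigr => i _; rewrite mxE mulrA. Qed.

Lemma dotNl u w : dot (- u) w = - dot u w.
Proof. by rewrite -scaleN1r dotZl mulN1r. Qed.

Lemma dotDr u v w : dot w (u + v) = dot w u + dot w v.
Proof. by rewrite dotC dotDl !(dotC w). Qed.

Lemma dotZr a u w : dot w (a *: u) = a * dot w u.
Proof. by rewrite dotC dotZl dotC. Qed.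

Lemma dotNr u w : dot w (- u) = - dot w u.
Proof. by rewrite dotC dotNl dotC. Qed.

Definition dotE := (dotDl, dotDr, dotNl, dotNr, dotZl, dotZr).

Lemma dot0l u : dot 0 u = 0.
Proof. by rewrite -(scale0r 0) dotZl mul0r. Qed.

Lemma dot_delta u (i : 'I_d) : dot u (delta_mx 0 i) = u 0 i.
Proof.
rewrite /dot (bigD1 i)//= mxE !eqxx mulr1 big1 ?addr0// => j ji.
by rewrite mxE (negbTE ji) andbF mulr0.
Qed.

Lemma dot_ge0 u : 0 <= dot u u.
Proof. by apply: sumr_ge0 => i _; rewrite -expr2 sqr_ge0. Qed.

Lemma norm2_sqr u : norm2 u ^+ 2 = dot u u.
Proof. by rewrite sqr_sqrtr// dot_ge0. Qed.

Lemma norm2_ge0 u : 0 <= norm2 u.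
Proof. exact: sqrtr_ge0. Qed.

Lemma norm2N u : norm2 (- u) = norm2 u.
Proof. by rewrite /norm2 !dotE opprK. Qed.

Lemma norm2Z a u : 0 <= a -> norm2 (a *: u) = a * norm2 u.
Proof.
by move=> a0; rewrite /norm2 !dotE mulrA sqrtrM ?mulr_ge0// -expr2 sqrtr_sqr ger0_norm.
Qed.

Lemma norm2_eq0 u : norm2 u = 0 -> u = 0.
Proof.
move=> u0; have := norm2_sqr u; rewrite u0 expr0n/= => /esym/eqP.
rewrite /dot psumr_eq0 => [/allP u00|i _]; last by rewrite -expr2 sqr_ge0.
apply/rowP => i; rewrite mxE.
by have /(_ (mem_index_enum _)) := u00 i; rewrite mulf_eq0 orbb => /eqP.
Qed.

(** Cauchy-Schwarz: expand the square of [norm2 v *: u - norm2 u *: v] and cancel the product of the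
    norms, hence the separate treatment of zero vectors. *)
Lemma dot_le_norm2 u v : dot u v <= norm2 u * norm2 v.
Proof.
have [/norm2_eq0 ->|u0] := eqVneq (norm2 u) 0.
  by rewrite dot0l mulr_ge0 ?norm2_ge0.
have [/norm2_eq0 ->|v0] := eqVneq (norm2 v) 0.
  by rewrite dotC dot0l mulr_ge0 ?norm2_ge0.
have uv0 : 0 < norm2 u * norm2 v.
  by rewrite mulr_gt0// lt_neqAle eq_sym norm2_ge0 ?u0 ?v0.
rewrite -(ler_pM2l uv0).
have := dot_ge0 (norm2 v *: u - norm2 u *: v).
rewrite !dotE (dotC v u) -!norm2_sqr; nra.
Qed.

Lemma ler_norm2D u v : norm2 (u + v) <= norm2 u + norm2 v.
Proof.
rewrite -(@ler_pXn2r _ 2)// ?nnegrE ?addr_ge0 ?norm2_ge0//.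
rewrite norm2_sqr !dotE (dotC v u) sqrrD !norm2_sqr.
have := dot_le_norm2 u v; lra.
Qed.

(** By the parallelogram law the two sides differ by the square of [norm2 (x + z)]. *)
Lemma norm2_sqrB_le x z :
  norm2 (x - z) ^+ 2 <= 2 * norm2 x ^+ 2 + 2 * norm2 z ^+ 2.
Proof.
by have := dot_ge0 (x + z); rewrite !norm2_sqr !dotE (dotC z x); lra.
Qed.

Lemma ler_norm_norm2 u : `|u| <= norm2 u.
Proof.
rewrite [leLHS]/Num.Def.normr/= mx_normrE; apply: bigmax_le; first exact: norm2_ge0.
move=> [i j] _ /=; rewrite (ord1 i) -sqrtr_sqr ler_sqrt ?dot_ge0//.
by rewrite /dot (bigD1 j)//= expr2 lerDl sumr_ge0// => k _; rewrite -expr2 sqr_ge0.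
Qed.

(** [bounded_set] refers to the sup norm; a sup bound [M] gives the Euclidean bound [M] times the
    square root of [d]. *)
Lemma bounded_norm2 (A : set 'rV[R]_d) : bounded_set A ->
  exists2 B : R, 0 <= B & forall a, A a -> norm2 a <= B.
Proof.
move=> /pinfty_ex_gt0[M M0 AM].
exists (Num.sqrt (M ^+ 2 *+ d)); first exact: sqrtr_ge0.
move=> a /AM /= aM; rewrite ler_sqrt ?mulrn_wge0 ?sqr_ge0// /dot.
rewrite -[d in leRHS]card_ord -sumr_const; apply: ler_sum => i _.
have : `|a 0 i| <= M.
  apply: le_trans aM; rewrite [leRHS]/Num.Def.normr/= mx_normrE.
  by apply/bigmax_geP; right; exists (0, i).
by rewrite -expr2 -real_normK ?num_real// => aiM; rewrite lerXn2r ?nnegrE ?(ltW M0).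
Qed.

Lemma continuous_norm2_sqr x : continuous (fun y => norm2 (y - x) ^+ 2).
Proof.
have -> : (fun y => norm2 (y - x) ^+ 2) =
    (fun y => \sum_(i < d) (y 0 i - x 0 i) * (y 0 i - x 0 i)).
  by apply/funext => y; rewrite norm2_sqr; apply: eq_bigr => i _; rewrite !mxE.
move=> y; apply: (@cvg_big _ _ _ _ _ add_continuous _ (nbhs y)) => i _.
by apply: cvgM; apply: cvgB; (exact: coord_continuous || exact: cvg_cst).
Qed.

End euclidean.

(** * Relative lower semicontinuity and existence of minimizers *)

Section semicontinuity.
Variables (R : realType) (d : nat) (X : set 'rV[R]_d).
Implicit Types (u v : 'rV[R]_d -> R) (x : 'rV[R]_d).

Lemma lsc_on_near u x a : lsc_on X u -> X x -> a < u x ->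
  \forall y \near x, X y -> a < u y.
Proof.
move=> ulsc Xx axu; have [V xV Vau] := ulsc x a axu.
have : within X (nbhs x) V by rewrite (nbhs_subspace_in Xx).
by apply: filterS => y /Vau; rewrite lte_fin.
Qed.

(** The sublevel sets at points of [K] generate a proper filter. A cluster point [p] is a minimizer:
    if [u x < u p], semicontinuity keeps the sublevel set of [x] away from [p]. *)
Lemma compact_lsc_argmin u (K : set 'rV[R]_d) : lsc_on X u ->
  compact K -> K `<=` X -> K !=set0 -> argmin K u !=set0.
Proof.
move=> ulsc Kco KX [x0 Kx0].
pose F := filter_from K (fun x => [set y | K y /\ u y <= u x]).
have FF : ProperFilter F.
  apply: filter_from_proper => [|x Kx]; last by exists x; split.
  apply: filter_from_filter => [|x y Kx Ky]; first by exists x0.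
  case: (leP (u x) (u y)) => xy; [exists x|exists y] => // z [Kz zx];
    do 2 split=> //; [exact: le_trans xy|exact: le_trans (ltW xy)].
have [|p [Kp Fp]] := Kco F FF; first by exists x0 => // y [].
exists p; split=> // x Kx; rewrite leNgt; apply/negP => xp.
have FKx : F [set y | K y /\ u y <= u x] by exists x.
have [y [[/= Ky yx] /(_ (KX _ Ky))]] := Fp _ _ FKx (lsc_on_near ulsc (KX _ Kp) xp).
by rewrite ltNge yx.
Qed.

Lemma lsc_onD u v : lsc_on X u -> lsc_on X v -> lsc_on X (u \+ v).
Proof.
move=> ulsc vlsc x a /=; rewrite lte_fin => axuv.
pose e := (u x + v x - a) / 2.
have e0 : 0 < e by rewrite divr_gt0// subr_gt0.
have [U xU Ue] := ulsc x (u x - e) ltac:(rewrite lte_fin; lra).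
have [V xV Ve] := vlsc x (v x - e) ltac:(rewrite lte_fin; lra).
exists (U `&` V); first exact: filterI.
move=> y [/Ue + /Ve]; rewrite !lte_fin /e; lra.
Qed.

Lemma continuous_lsc_on u : continuous u -> lsc_on X u.
Proof.
move=> uc x a; rewrite lte_fin => axu.
exists [set y | a < u y] => [|y /=]; last by rewrite lte_fin.
have : nbhs (x : 'rV[R]_d) [set y | a < u y] by apply: (cvgr_gt _ (uc x)).
exact: (@incl_subspace_continuous _ X x).
Qed.

End semicontinuity.

(** * Minimum values, distances and convex combinations *)

Section minimization.
Variables (R : realType) (d : nat) (X : set 'rV[R]_d).
Implicit Types (u : 'rV[R]_d -> R) (x p a : 'rV[R]_d).

Lemma minval_argmin u p : argmin X u p -> minval X u = u p.
Proof.
move=> [Xp pmin]; apply/le_anti/andP; split.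
  by apply: ge_inf; [exists (u p) => _ [y Xy <-]; exact: pmin|exists p].
by apply: lb_le_inf => [|_ [y Xy <-]]; [exists (u p), p|exact: pmin].
Qed.

Lemma dist2_ge (A : set 'rV[R]_d) x (B : R) :
  (forall a, A a -> norm2 a <= B) -> ((norm2 x - B)%:E <= dist2 x A)%E.
Proof.
move=> AB; apply: le_ereal_inf_tmp => _ [a Aa <-]; rewrite lee_fin.
by have := ler_norm2D (x - a) a; rewrite subrK; have := AB a Aa; lra.
Qed.

Lemma dist2_ge0 (A : set 'rV[R]_d) x : (0 <= dist2 x A)%E.
Proof. by apply: le_ereal_inf_tmp => _ [a _ <-]; rewrite lee_fin norm2_ge0. Qed.

Lemma convex_set_comb (x y : 'rV[R]_d) (t : R) : convex_set X ->
  0 <= t -> t <= 1 -> X x -> X y -> X (t *: x + (1 - t) *: y).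
Proof.
by move=> Xc t0 t1 Xx Xy; have /set_mem := Xc x y (Itv01 t0 t1) (mem_set Xx) (mem_set Xy).
Qed.

Lemma convex_function_comb u (x y : 'rV[R]_d) (t : R) : convex_function X u ->
  0 <= t -> t <= 1 -> X x -> X y ->
  u (t *: x + (1 - t) *: y) <= t * u x + (1 - t) * u y.
Proof.
by move=> uc t0 t1 Xx Xy; exact: (uc (Itv01 t0 t1) x y (mem_set Xx) (mem_set Xy)).
Qed.

Lemma weakly_convexD (rho eta : R) u (v : 'rV[R]_d -> R) :
  weakly_convex X rho u -> weakly_convex X eta v ->
  weakly_convex X (rho + eta) (u \+ v).
Proof.
move=> uc vc t x y Xx Xy; have := lerD (uc t x y Xx Xy) (vc t x y Xx Xy).
rewrite /add_quad !convRE /=; lra.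
Qed.

End minimization.

(** A quadratic error puts the difference quotient within [C * |h|] of [k]. *)
Lemma derive_quad_error (R : realType) (V : normedModType R) (F : V -> R)
    (x v : V) (k C : R) :
  (forall h, `|F (h *: v + x) - F x - h * k| <= C * h ^+ 2) -> 'D_v F x = k.
Proof.
move=> FC; apply: cvg_lim => //; apply/cvgrPdist_le => e e0.
have C0 : 0 <= C by have := FC 1; rewrite expr1n mulr1; apply: le_trans.
(* [C + 1] replaces [C], which may vanish. *)
have e'0 : 0 < e / (C + 1) by rewrite divr_gt0// ltr_wpDl.
near=> h.
have h0 : h != 0 by near: h; exact: nbhs_dnbhs_neq.
have he : `|h| <= e / (C + 1) by near: h; exact: dnbhs0_le.
have -> : k - h^-1 *: (F (h *: v + x) - F x) =
    - (h^-1 * (F (h *: v + x) - F x - h * k)).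
  by rewrite /GRing.scale/=; field.
rewrite normrN normrM normfV ler_pdivrMl ?normr_gt0//.
apply: le_trans (FC h) _; rewrite -real_normK ?num_real// expr2.
rewrite mulrC -mulrA ler_wpM2l// mulrC.
have : `|h| * (C + 1) <= e by rewrite -ler_pdivlMr// ltr_wpDl.
by have := normr_ge0 h; nra.
Unshelve. all: by end_near. Qed.

(* Sandwiching the increment of the Moreau envelope between the values of both
   objectives at both minimizers; [w] is the displacement of the minimizer. *)
Lemma quad_sandwich (R : realType) (d : nat) (v y w : 'rV[R]_d) (a b l s h : R) :
  0 < l -> 0 < s -> dot v v = 1 ->
  a + l / 2 * norm2 y ^+ 2 + s / 2 * norm2 w ^+ 2 <=
    b + l / 2 * norm2 (w + y) ^+ 2 ->
  b + l / 2 * norm2 (w + y - h *: v) ^+ 2 <=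
    a + l / 2 * norm2 (y - h *: v) ^+ 2 ->
  `|b + l / 2 * norm2 (w + y - h *: v) ^+ 2 - (a + l / 2 * norm2 y ^+ 2)
    + h * (l * dot y v)| <= (l / 2 + l ^+ 2 / (2 * s)) * h ^+ 2.
Proof.
move=> l0 s0 v1; rewrite !norm2_sqr !dotE v1 (dotC v w) (dotC v y) (dotC y w).
(* Completing the square: the growth term in [w] absorbs the cross term [l * h * dot w v] at a cost
   of order [h ^+ 2]. *)
have sq : 0 <= s / 2 * dot w w - l * h * dot w v + l ^+ 2 / (2 * s) * h ^+ 2.
  have := dot_ge0 (w - (l * h / s) *: v); rewrite !dotE v1 (dotC v w) => ww.
  rewrite (_ : s / 2 * _ - _ + _ = s / 2 * (dot w w - (l * h / s) * dot w v
      - ((l * h / s) * dot w v - (l * h / s) * ((l * h / s) * 1)))).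
    by rewrite mulr_ge0 ?divr_ge0 ?(ltW s0)//; move: ww; lra.
  by field; rewrite gt_eqF.
have K0 : 0 <= l ^+ 2 / (2 * s) by rewrite divr_ge0 ?sqr_ge0 ?mulr_ge0 ?(ltW s0).
move: (l ^+ 2 / _) K0 sq => K K0 sq.
have Kh : 0 <= K * h ^+ 2 by rewrite mulr_ge0 ?sqr_ge0.
have lh : 0 <= l * h ^+ 2 by rewrite mulr_ge0 ?sqr_ge0 ?(ltW l0).
by move=> lo up; rewrite ler_norml; apply/andP; split; lra.
Qed.

(** * Proximal points, the Moreau envelope and its gradient *)

Section moreau_envelope.
Variables (R : realType) (d : nat) (X : set 'rV[R]_d).
Variables (u : 'rV[R]_d -> R) (mu lam : R).
Hypotheses (Xcl : closed X) (Xc : convex_set X) (u_lsc : lsc_on X u).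
Hypothesis u_argmin : argmin X u !=set0.
Hypotheses (u_wc : weakly_convex X mu u) (lam_gt0 : 0 < lam).
Hypotheses (mu_ge0 : 0 <= mu) (lammu : lam * mu < 1).
Implicit Types x y z v : 'rV[R]_d.

Let ulam_gt0 : 0 < (2 * lam)^-1. Proof. by rewrite invr_gt0 mulr_gt0. Qed.

Let mu_lt : mu < lam^-1.
Proof. by rewrite -(ltr_pM2l lam_gt0) divff ?gt_eqF. Qed.

Lemma prox_obj_lsc x : lsc_on X (prox_obj lam u x).
Proof.
apply: (@lsc_onD _ _ X u) => //; apply: continuous_lsc_on => y.
exact: (cvgM (cvg_cst _) (@continuous_norm2_sqr _ _ x y)).
Qed.

(** Let [z] minimize [u]. Outside the sup-norm ball around [x] of radius [norm2 (z - x)], both terms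
    of the objective are at least their values at [z], so minimizing over the compact part [K]
    suffices. *)
Lemma prox_argmin x : argmin X (prox_obj lam u x) (prox X lam u x).
Proof.
apply: xgetPex; have [z [Xz zmin]] := u_argmin.
pose K := X `&` closed_ball_ Num.Def.normr x (norm2 (z - x)).
have Kz : K z.
  by split=> //; rewrite /closed_ball_/= distrC ler_norm_norm2.
have Kco : compact K.
  apply: bounded_closed_compact; last first.
    by apply: closedI => //; exact: closed_closed_ball_.
  exists (`|x| + norm2 (z - x)); split; first exact: num_real.
  move=> M /ltW xM y [_]; rewrite /closed_ball_/= => xy.
  have : `|y| <= `|x| + norm2 (z - x).
    rewrite -[y](subKr x); apply: le_trans (ler_normB _ _) _.
    by rewrite lerD2l.
  by move=> /le_trans; exact.
have [p [[Xp _] pmin]] := compact_lsc_argmin (@prox_obj_lsc x) Kco (@subIsetl _ _ _)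
  (ex_intro _ z Kz).
exists p; split=> // y Xy.
have [xy|xy] := leP `|x - y| (norm2 (z - x)); first exact: pmin.
apply: le_trans (pmin z Kz) _; apply: lerD; first exact: zmin.
rewrite ler_pM2l// ler_pXn2r ?nnegrE ?norm2_ge0//; apply: ltW.
by apply: lt_le_trans xy _; rewrite distrC ler_norm_norm2.
Qed.

Lemma prox_in x : X (prox X lam u x). Proof. by have [] := prox_argmin x. Qed.

Lemma moreauE x : moreau X lam u x = prox_obj lam u x (prox X lam u x).
Proof. exact/minval_argmin/prox_argmin. Qed.

(* Comparing the minimizer with points of the segment to [y] that tend to it
   turns strong convexity into quadratic growth. *)
Lemma prox_obj_growth x y : X y ->
  prox_obj lam u x (prox X lam u x)
    + (lam^-1 - mu) / 2 * norm2 (y - prox X lam u x) ^+ 2 <= prox_obj lam u x y.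
Proof.
move=> Xy; have [Xp pmin] := prox_argmin x; set p := prox X lam u x in Xp pmin *.
set c := (lam^-1 - mu) / 2 * _.
(* At parameter [t] strong convexity bounds the objective by the average of the end values minus
   [t * (1 - t) * c]; minimality of [p] bounds it below, and [t] is divided out. *)
have seg t : 0 < t -> t <= 1 ->
    prox_obj lam u x p + (1 - t) * c <= prox_obj lam u x y.
  move=> t0 t1; have := pmin _ (convex_set_comb Xc (ltW t0) t1 Xy Xp).
  have := convex_function_comb u_wc (ltW t0) t1 Xy Xp.
  rewrite /c /add_quad /prox_obj !norm2_sqr invfM !dotE.
  rewrite (dotC p y) (dotC x y) (dotC x p).
  move=> h1 h2; rewrite -(ler_pM2l t0); lra.
rewrite -subr_ge0; apply/ler_addgt0Pr => e e0.
have c0 : 0 <= c.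
  by rewrite mulr_ge0 ?sqr_ge0// divr_ge0// subr_ge0; exact: ltW.
(* With this [t] the loss [t * c] is at most [e]. *)
pose t := Num.min 1 (e / (c + 1)).
clearbody c; have c1 : 0 < c + 1 by rewrite ltr_wpDl.
have t0 : 0 < t by rewrite lt_min ltr01 divr_gt0.
have t1 : t <= 1 by rewrite ge_min lexx.
have : t * (c + 1) <= e by rewrite -ler_pdivlMr// ge_min lexx orbT.
have := seg t t0 t1; clearbody t; lra.
Qed.

(** Each partial derivative is found by testing the proximal points [p] of [x] and [q] of
    [h *: v + x] in each other's problem; the growth at [p] controls [q - p]. *)
Lemma grad_moreau x : grad (moreau X lam u) x = lam^-1 *: (x - prox X lam u x).
Proof.
apply/rowP => i; rewrite !mxE; set v := delta_mx 0 i.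
set p := prox X lam u x; set s := lam^-1 - mu.
have s0 : 0 < s by rewrite subr_gt0.
have l0 : 0 < lam^-1 by rewrite invr_gt0.
have v1 : dot v v = 1 by rewrite dot_delta mxE !eqxx.
have -> : lam^-1 * (x 0 i - p 0 i) = - (lam^-1 * dot (p - x) v).
  by rewrite dot_delta !mxE -mulrN opprB.
apply: (@derive_quad_error _ _ _ _ _ _ (lam^-1 / 2 + lam^-1 ^+ 2 / (2 * s))) => h.
rewrite !moreauE -/p; set q := prox X lam u (h *: v + x).
have lo : prox_obj lam u x p + s / 2 * norm2 (q - p) ^+ 2 <= prox_obj lam u x q.
  exact/prox_obj_growth/prox_in.
have up : prox_obj lam u (h *: v + x) q <= prox_obj lam u (h *: v + x) p.
  by have [_] := prox_argmin (h *: v + x); apply; exact: prox_in.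
have half : (2 * lam)^-1 = lam^-1 / 2 by rewrite invfM mulrC.
move: lo up; rewrite /prox_obj half; clearbody p q s v.
rewrite mulrN opprK.
(* Rewriting in terms of [y = p - x] and [w = q - p] to match the sandwich. *)
have <- : (q - p) + (p - x) = q - x by rewrite addrA subrK.
have <- : (q - p) + (p - x) - h *: v = q - (h *: v + x).
  by rewrite addrA subrK opprD addrA addrAC.
have <- : (p - x) - h *: v = p - (h *: v + x) by rewrite opprD addrA addrAC.
move=> lo up; exact: (quad_sandwich l0 s0 v1 lo up).
Qed.

Lemma moreau_gap_ge x : u (prox X lam u x) - minval X u
    + (2 * lam)^-1 * norm2 (x - prox X lam u x) ^+ 2
  <= moreau X lam u x - minval X u.
Proof. by rewrite moreauE /prox_obj -norm2N opprB; lra. Qed.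

(** [z] is a competitor in the proximal problem, and its value [u z] is the minimum that is
    subtracted. *)
Lemma moreau_gap_le x z : argmin X u z ->
  moreau X lam u x - minval X u <= (2 * lam)^-1 * norm2 (x - z) ^+ 2.
Proof.
move=> uz; have [Xz _] := uz; rewrite moreauE (minval_argmin uz).
have [_ /(_ z Xz)] := prox_argmin x; rewrite {2}/prox_obj -norm2N opprB; lra.
Qed.

Lemma prox_gap_ge0 x : 0 <= u (prox X lam u x) - minval X u.
Proof.
have [z uz] := u_argmin; rewrite (minval_argmin uz) subr_ge0.
by have [_] := uz; apply; exact: prox_in.
Qed.

(** The two gap estimates combine, because [u] at the proximal point is at least its minimum. *)
Lemma norm2_subr_prox x z : argmin X u z ->
  norm2 (x - prox X lam u x) <= norm2 (x - z).
Proof.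
move=> uz; rewrite -(@ler_pXn2r _ 2)// ?nnegrE ?norm2_ge0// -(ler_pM2l ulam_gt0).
apply: le_trans (moreau_gap_le x uz); apply: le_trans (moreau_gap_ge x).
by rewrite lerDr prox_gap_ge0.
Qed.

(** Expanding the growth inequality around [p] cancels the [lam^-1] squares and leaves the
    subgradient inequality with its [mu] correction; the normal part is 0. *)
Lemma subdiff_normal_prox x :
  subdiff_normal X mu u (prox X lam u x) (lam^-1 *: (x - prox X lam u x)).
Proof.
set p := prox X lam u x; exists (lam^-1 *: (x - p)).
  exists (lam^-1 *: (x - p) + mu *: p); last by rewrite addrK.
  move=> y /(@prox_obj_growth x); rewrite -/p /prox_obj /add_quad !norm2_sqr invfM.
  rewrite !dotE (dotC p y) (dotC x y) (dotC x p); lra.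
by exists 0; rewrite ?addr0// => y _; rewrite dot0l.
Qed.

(** At a minimizer [z], [mu *: z] is a subgradient of [add_quad mu u], since the added quadratic is
    convex for [mu >= 0]. *)
Lemma argmin_critical : argmin X u `<=` critical X mu u.
Proof.
move=> z [Xz zmin]; split=> //; exists 0.
  exists (mu *: z); last by rewrite subrr.
  move=> y Xy; rewrite /add_quad !norm2_sqr !dotE.
  have := zmin y Xy; have := mulr_ge0 mu_ge0 (dot_ge0 (y - z)).
  rewrite !dotE (dotC z y); lra.
by exists 0; rewrite ?addr0// => y _; rewrite dot0l.
Qed.

End moreau_envelope.

(** * Exchanging linear and square-root bounds *)

Section bound_equivalence.
Variables (R : realType) (d : nat) (X : set 'rV[R]_d).
Variables (f r : 'rV[R]_d -> R) (rho eta : R).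

(** The constants come from [(a + b)^2 <= 2 a^2 + 2 b^2] with [a = c1 * norm2 x] and [b = c2]. *)
Lemma linear_bound_sqrt (w : 'rV[R]_d -> R) :
  (exists A B : R, [/\ 0 <= A, 0 <= B &
    forall x, X x -> norm2 x ^+ 2 <= A * w x + B]) ->
  linear_bound X rho eta f r ->
  exists c c' : R, [/\ 0 <= c, 0 <= c' &
    forall x g h, X x -> subdiff X rho f x g -> subdiff X eta r x h ->
      norm2 (g + h) <= Num.sqrt (c * w x + c')].
Proof.
move=> [A [B [A0 B0 xw]]] [c1 [c2 [c10 c20 gh]]].
exists (2 * c1 ^+ 2 * A), (2 * c1 ^+ 2 * B + 2 * c2 ^+ 2).
split; [|by rewrite addr_ge0 ?mulr_ge0 ?sqr_ge0|].
  by rewrite !mulr_ge0 ?sqr_ge0.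
move=> x g h Xx fg rh; apply: le_trans (gh _ _ _ Xx fg rh) _.
have sum_ge0 : 0 <= c1 * norm2 x + c2 by rewrite addr_ge0 ?mulr_ge0 ?norm2_ge0.
rewrite -[leLHS]ger0_norm// -sqrtr_sqr; apply: ler_wsqrtr.
have c1xw : c1 ^+ 2 * norm2 x ^+ 2 <= c1 ^+ 2 * (A * w x + B).
  by rewrite ler_wpM2l ?sqr_ge0 ?xw.
have := sqr_ge0 (c1 * norm2 x - c2); lra.
Qed.

(** Subadditivity of the square root, applied to [c * A * norm2 x ^+ 2] and [c * B + c']. *)
Lemma sqrt_bound_linear (w : 'rV[R]_d -> R) :
  (exists A B : R, [/\ 0 <= A, 0 <= B &
    forall x, X x -> w x <= A * norm2 x ^+ 2 + B]) ->
  (exists c c' : R, [/\ 0 <= c, 0 <= c' &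
    forall x g h, X x -> subdiff X rho f x g -> subdiff X eta r x h ->
      norm2 (g + h) <= Num.sqrt (c * w x + c')]) ->
  linear_bound X rho eta f r.
Proof.
move=> [A [B [A0 B0 wx]]] [c [c' [c0 c'0 gh]]].
exists (Num.sqrt (c * A)), (Num.sqrt (c * B + c')); split; try exact: sqrtr_ge0.
move=> x g h Xx fg rh; apply: le_trans (gh _ _ _ Xx fg rh) _.
set a := Num.sqrt (c * A); set b := Num.sqrt (c * B + c').
have x0 := norm2_ge0 x.
have [a0 b0] : 0 <= a /\ 0 <= b by split; exact: sqrtr_ge0.
have ab0 : 0 <= a * norm2 x + b by rewrite addr_ge0 ?mulr_ge0.
rewrite -[leRHS]ger0_norm// -sqrtr_sqr; apply: ler_wsqrtr.
have cw : c * w x <= c * (A * norm2 x ^+ 2 + B) by rewrite ler_wpM2l ?wx.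
have a2 : a ^+ 2 = c * A by rewrite sqr_sqrtr ?mulr_ge0.
have b2 : b ^+ 2 = c * B + c' by rewrite sqr_sqrtr ?addr_ge0 ?mulr_ge0.
have abx : 0 <= a * norm2 x * b by rewrite !mulr_ge0.
rewrite sqrrD exprMn a2 b2; lra.
Qed.

End bound_equivalence.

(** * Comparing the squared norm with the gap and with the gradient *)

Section growth.
Variables (R : realType) (d : nat) (X : set 'rV[R]_d).
Variables (u : 'rV[R]_d -> R) (mu lam : R).
Hypotheses (Xcl : closed X) (Xc : convex_set X) (u_lsc : lsc_on X u).
Hypothesis u_argmin : argmin X u !=set0.
Hypotheses (u_wc : weakly_convex X mu u) (lam_gt0 : 0 < lam).
Hypotheses (mu_ge0 : 0 <= mu) (lammu : lam * mu < 1).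
Implicit Types x z : 'rV[R]_d.

Lemma moreau_gap_le_sqr : exists A B : R, [/\ 0 <= A, 0 <= B &
  forall x, X x -> moreau X lam u x - minval X u <= A * norm2 x ^+ 2 + B].
Proof.
have [z uz] := u_argmin; have l0 : 0 <= (2 * lam)^-1 by rewrite invr_ge0 ltW ?mulr_gt0.
exists ((2 * lam)^-1 * 2), ((2 * lam)^-1 * (2 * norm2 z ^+ 2)).
split; [by rewrite mulr_ge0|by rewrite mulr_ge0// mulr_ge0// sqr_ge0|].
move=> x Xx; apply: le_trans (moreau_gap_le Xcl u_lsc u_argmin lam_gt0 x uz) _.
by rewrite -mulrA -mulrDr ler_wpM2l// norm2_sqrB_le.
Qed.

Lemma norm2_grad_moreau x :
  norm2 (grad (moreau X lam u) x) = lam^-1 * norm2 (x - prox X lam u x).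
Proof. by rewrite (grad_moreau (mu := mu))// norm2Z// invr_ge0 ltW. Qed.

Lemma norm2_subr_proxE x :
  norm2 (x - prox X lam u x) = lam * norm2 (grad (moreau X lam u) x).
Proof. by rewrite norm2_grad_moreau mulrA divff ?gt_eqF ?mul1r. Qed.

(** The gradient is [lam^-1] times the proximal displacement, which is at most the distance to a
    fixed minimizer [z]. *)
Lemma moreau_grad_le_sqr : exists A B : R, [/\ 0 <= A, 0 <= B &
  forall x, X x ->
    norm2 (grad (moreau X lam u) x) ^+ 2 <= A * norm2 x ^+ 2 + B].
Proof.
have [z uz] := u_argmin; have l0 := sqr_ge0 lam^-1.
exists (lam^-1 ^+ 2 * 2), (lam^-1 ^+ 2 * (2 * norm2 z ^+ 2)).
split; [by rewrite mulr_ge0|by rewrite mulr_ge0// mulr_ge0// sqr_ge0|].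
move=> x Xx; rewrite norm2_grad_moreau exprMn -[_ * 2 * _]mulrA -mulrDr.
apply: ler_wpM2l => //; apply: le_trans (norm2_sqrB_le x z).
by rewrite lerXn2r ?nnegrE ?norm2_ge0// norm2_subr_prox.
Qed.

(** Split [norm2 x <= norm2 (x - p) + e + M], where [e] is the excess of [norm2 p] over [M]. The gap
    times [2 * lam] bounds the first square, the gap times [k] bounds [e ^+ 2]; the factor 3 comes
    from squaring a sum of three terms. *)
Lemma sqr_le_moreau_gap : global_quadratic_growth X u ->
  bounded_set (critical X mu u) -> exists A B : R, [/\ 0 <= A, 0 <= B &
  forall x, X x -> norm2 x ^+ 2 <= A * (moreau X lam u x - minval X u) + B].
Proof.
move=> [k k0 qg] /bounded_norm2[M M0 critM].
exists (3 * (k + 2 * lam)), (3 * M ^+ 2).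
split; [by rewrite mulr_ge0// addr_ge0 ?mulr_ge0// ltW|by rewrite mulr_ge0 ?sqr_ge0|].
move=> x Xx; set p := prox X lam u x.
have Xp : X p by exact: prox_in.
(* Truncated at 0 so that the bound by the distance survives squaring. *)
pose e := Num.max 0 (norm2 p - M).
have e0 : 0 <= e by rewrite le_max lexx.
have pe : norm2 p <= e + M by rewrite -lerBlDr le_max lexx orbT.
have e2 : e ^+ 2 <= k * (u p - minval X u).
  rewrite -lee_fin; apply: le_trans (qg p Xp); rewrite EFin_expe !expe2.
  have de : (e%:E <= dist2 p (argmin X u))%E.
    rewrite /e /Num.max; case: ifP => _; last exact: dist2_ge0.
    by apply: dist2_ge => a /(argmin_critical mu_ge0) /critM.
  by apply: lee_pmul; rewrite ?lee_fin.
have gap := moreau_gap_ge Xcl u_lsc u_argmin lam_gt0 x; rewrite -/p in gap.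
have gap0 := prox_gap_ge0 Xcl u_lsc u_argmin lam_gt0 x; rewrite -/p in gap0.
have gap' : 2 * lam * (u p - minval X u) + norm2 (x - p) ^+ 2 <=
    2 * lam * (moreau X lam u x - minval X u).
  have l2 : 0 < 2 * lam by rewrite mulr_gt0.
  by rewrite -(ler_pM2l l2) mulrDr mulrA divff ?gt_eqF// mul1r in gap.
have gap'' : u p - minval X u <= moreau X lam u x - minval X u.
  apply: le_trans gap; rewrite lerDl mulr_ge0 ?sqr_ge0// invr_ge0.
  by rewrite mulr_ge0 ?(ltW lam_gt0).
have kgap := ler_wpM2l (ltW k0) gap''.
have lgap : 0 <= 2 * lam * (u p - minval X u).
  by rewrite mulr_ge0// mulr_ge0 ?(ltW lam_gt0).
have xle : norm2 x <= norm2 (x - p) + e + M.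
  by have := ler_norm2D (x - p) p; rewrite subrK; lra.
have x2 : norm2 x ^+ 2 <= (norm2 (x - p) + e + M) ^+ 2.
  by rewrite lerXn2r ?nnegrE ?addr_ge0 ?norm2_ge0.
move: (norm2 (x - p)) gap' x2 => t gap' x2.
(* These squares add up to [3 (t^2 + e^2 + M^2) - (t + e + M)^2]. *)
have := sqr_ge0 (t - e); have := sqr_ge0 (t - M); have := sqr_ge0 (e - M).
lra.
Qed.

Lemma affine_sqr_le (A B : R) : 0 <= A -> 0 <= B ->
  (forall x, X x -> norm2 x <= A * norm2 (grad (moreau X lam u) x) + B) ->
  exists A' B' : R, [/\ 0 <= A', 0 <= B' & forall x, X x ->
    norm2 x ^+ 2 <= A' * norm2 (grad (moreau X lam u) x) ^+ 2 + B'].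
Proof.
move=> A0 B0 xAB; exists (2 * A ^+ 2), (2 * B ^+ 2).
split; try by rewrite mulr_ge0 ?sqr_ge0.
move=> x Xx; set t := norm2 (grad _ _).
have t0 : 0 <= t by exact: norm2_ge0.
have x2 : norm2 x ^+ 2 <= (A * t + B) ^+ 2.
  by rewrite lerXn2r ?nnegrE ?addr_ge0 ?mulr_ge0 ?norm2_ge0 ?xAB.
apply: le_trans x2 _; have := sqr_ge0 (A * t - B); lra.
Qed.

(** Subregularity at [p] gives [norm2 p - M <= k * norm2 grad], and [norm2 (x - p)] is
    [lam * norm2 grad]. *)
Lemma sqr_le_moreau_grad_subregular : global_metric_subregularity X mu u ->
  bounded_set (critical X mu u) -> exists A B : R, [/\ 0 <= A, 0 <= B &
  forall x, X x -> norm2 x ^+ 2 <=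
    A * norm2 (grad (moreau X lam u) x) ^+ 2 + B].
Proof.
move=> [k k0 sr] /bounded_norm2[M M0 critM].
apply: (@affine_sqr_le (lam + k) M) => //; first by rewrite addr_ge0 ?ltW.
move=> x Xx; have := norm2_subr_proxE x; set p := prox X lam u x => xp.
have pM : norm2 p - M <= k * norm2 (grad (moreau X lam u) x).
  rewrite -lee_fin EFinM; apply: le_trans (dist2_ge p critM) _.
  apply: le_trans (sr p (prox_in Xcl u_lsc u_argmin lam_gt0 x)) _.
  apply: lee_wpmul2l; first by rewrite lee_fin ltW.
  (* The gradient at [x] belongs to the subdifferential set at [p], so its norm bounds the distance
     from 0. *)
  apply: ereal_inf_lbound; exists (grad (moreau X lam u) x).
    by rewrite (grad_moreau (mu := mu))//; exact: subdiff_normal_prox.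
  by rewrite sub0r norm2N.
have := ler_norm2D (x - p) p; rewrite subrK xp; lra.
Qed.

(** For [norm2 x >= R0] the triangle inequality gives [(1 - tau) * norm2 x <= norm2 (x - p)]; the
    other points have norm at most [R0]. *)
Lemma sqr_le_moreau_grad_contraction (tau R0 : R) : tau < 1 -> 0 <= R0 ->
  (forall x, X x -> R0 <= norm2 x -> norm2 (prox X lam u x) <= tau * norm2 x) ->
  exists A B : R, [/\ 0 <= A, 0 <= B & forall x, X x ->
    norm2 x ^+ 2 <= A * norm2 (grad (moreau X lam u) x) ^+ 2 + B].
Proof.
move=> tau1 R00 ptau; have tau0 : 0 < 1 - tau by rewrite subr_gt0.
have A0 : 0 <= lam / (1 - tau) by rewrite divr_ge0// ltW.
apply: (@affine_sqr_le (lam / (1 - tau)) R0) => // x Xx.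
have [xR|/ltW xR] := leP R0 (norm2 x); last first.
  by apply: le_trans xR _; rewrite lerDr mulr_ge0 ?norm2_ge0.
rewrite -[leLHS]addr0 lerD// mulrAC -norm2_subr_proxE ler_pdivlMr//.
by have := ler_norm2D (x - prox X lam u x) (prox X lam u x);
  rewrite subrK; have := ptau x Xx xR; lra.
Qed.

End growth.

(* The bound on lam is stated in \bar R, where 0^-1 = +oo, so that the convex
   case rho + eta = 0 is not lost. *)
Theorem proposition3p2 (R : realType) (d : nat) (X : set 'rV[R]_d)
    (f r : 'rV[R]_d -> R) (rho eta lam : R)
    (phi := f \+ r)
    (X_closed : closed X) (X_convex : convex_set X)
    (f_lsc : lsc_on X f) (r_lsc : lsc_on X r)
    (argmin_neq0 : argmin X phi !=set0)
    (f_wconvex : weakly_convex X rho f)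
    (r_wconvex : weakly_convex X eta r)
    (lam_gt0 : 0 < lam)
    (lam_lt : (lam%:E < (rho + eta)%:E^-1)%E) :
  [/\ (global_quadratic_growth X phi ->
       bounded_set (critical X (rho + eta) phi) ->
       linear_bound X rho eta f r <-> moreau_gap_bound X rho eta lam f r),
      (global_metric_subregularity X (rho + eta) phi ->
       bounded_set (critical X (rho + eta) phi) ->
       linear_bound X rho eta f r <-> moreau_grad_bound X rho eta lam f r) &
      ((exists tau R0 : R, [/\ 0 < tau, tau < 1, 0 < R0 &
          forall x, X x -> R0 <= norm2 x ->
            norm2 (prox X lam phi x) <= tau * norm2 x]) ->
       linear_bound X rho eta f r <-> moreau_grad_bound X rho eta lam f r)].
Proof.
have phi_lsc : lsc_on X phi by exact: lsc_onD.
have phi_wc : weakly_convex X (rho + eta) phi by exact: weakly_convexD.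
(* A negative [rho + eta] would have a negative inverse, which cannot exceed [lam > 0]; for a zero
   sum the product is 0. *)
have [mu0 lammu] : 0 <= rho + eta /\ lam * (rho + eta) < 1.
  move: lam_lt; rewrite inver; case: eqVneq => [->|mu0]; first by rewrite mulr0.
  rewrite lte_fin => lam_ltV.
  have mu_gt0 : 0 < rho + eta by rewrite -invr_gt0 (lt_trans lam_gt0).
  by rewrite (ltW mu_gt0) -ltr_pdivlMr// mul1r.
(* This converse serves both the second and the third case. *)
have grad_linear : moreau_grad_bound X rho eta lam f r ->
    linear_bound X rho eta f r.
  by apply: sqrt_bound_linear; exact: (moreau_grad_le_sqr (mu := rho + eta)).
split.
- move=> qg bc; split.
    by apply: linear_bound_sqrt; exact: (sqr_le_moreau_gap (mu := rho + eta)).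
  by apply: sqrt_bound_linear; exact: moreau_gap_le_sqr.
- move=> sr bc; split=> //; apply: linear_bound_sqrt.
  exact: (sqr_le_moreau_grad_subregular (mu := rho + eta)).
- move=> [tau [R0 [_ tau1 /ltW R00 ptau]]]; split=> //; apply: linear_bound_sqrt.
  by apply: (sqr_le_moreau_grad_contraction X_closed X_convex phi_lsc
    argmin_neq0 phi_wc lam_gt0 lammu tau1 R00).
Qed.
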